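(* Let $2\le k\le\omega$ and let $\mathbb N$ be the discrete space of natural numbers. The effective Wadge hierarchy $\{\Sigma(\mathbb N,T)\}_{T\in\mathcal T_\omega(\bar k)}$ of $k$-partitions of $\mathbb N$ strongly does not collapse, i.e. for every $T\in\mathcal T_\omega(\bar k)$, $$\Sigma(\mathbb N,T)\not\subseteq\bigcup\{\Sigma(\mathbb N,V)\mid V\in\mathcal T_\omega(\bar k),\ T\not\le_h V\}.$$
   Context: Let $\bar k=\{i\in\omega: i<k\}$ regarded as an antichain; a $k$-partition of a set $Y$ is a function $A:Y\to\bar k$. Let $\omega^*$ be the set of finite sequences of naturals, $\sqsubseteq$ the prefix relation, $\varepsilon$ the empty sequence. A finite normal tree is a finite nonempty $T\subseteq\omega^*$ closed under prefixes such that $\tau(i+1)\in T$ implies $\tau i\in T$. For a preorder $(Q;\le_Q)$, a $Q$-tree is a pair $(T,t)$ with $T$ a finite normal tree and $t:T\to Q$; $\mathcal T(Q)$ is the set of $Q$-trees with the h-preorder: $(T,t)\le_h(V,v)$ iff there is a $\sqsubseteq$-monotone $f:T\to V$ with $t(\tau)\le_Q v(f(\tau))$ for all $\tau\in T$. Put $\mathcal T_0(\bar k)=\bar k$, $\mathcal T_{m+1}(\bar k)=\mathcal T(\mathcal T_m(\bar k))$. Let $g_0(i)=(\{\varepsilon\},i)$, $g_{m+1}(T,t)=(T,g_m\circ t)$ (embeddings $\mathcal T_m(\bar k)\to\mathcal T_{m+1}(\bar k)$), $g_{m,p}=g_{p-1}\circ\cdots\circ g_m$. $\mathcal T_\omega(\bar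 k)$ is the disjoint union of all $\mathcal T_m(\bar k)$, with $T\le_h V$ (for $T\in\mathcal T_m(\bar k)$, $V\in\mathcal T_n(\bar k)$) iff $g_{m,p}(T)\le_h g_{n,p}(V)$, $p=\max(m,n)$. Hierarchy on $\mathbb N$: let $\Sigma^0_{1+n}(\mathbb N)$ be the $\Sigma^0_{n+1}$ level of the arithmetical hierarchy. For $Y\subseteq\omega$ and $n,j<\omega$ put $\mathcal L^n_j(Y)=\{Y\cap S: S\in\Sigma^0_{1+n+j}(\mathbb N)\}$. By induction on $m$ define, for $T\in\mathcal T_m(\bar k)$, a ''$T$-family in $\mathcal L^n(Y)$'' and the $k$-partition of $Y$ it determines: if $m=0$, $T=i<k$, the only $T$-family is $\{Y\}$ and it determines the constant partition $i$; if $(T,t)\in\mathcal T_{m+1}(\bar k)$, a $T$-family is a pair $(\{U_\tau\}_{\tau\in T},\{F_\tau\}_{\tau\in T})$ with $U_\tau\in\mathcal L^n_0(Y)$, $U_\varepsilon=Y$, $U_\tau\supseteq U_{\tau'}$ for $\tau\sqsubseteq\tau'$, and each $F_\tau$ a $t(\tau)$-family in $\mathcal L^{n+1}(\tilde U_\tau)$ where $\tilde U_\tau=U_\tau\setminus\bigcup\{U_{\tau'}:\tau\sqsubset\tau'\in T\}$; it determines the $A:Y\to\bar k$ whose restriction to each $\tilde U_\tau$ is the partition determined by $F_\tau$. $\Sigma(\mathbb N,T)$ is the set of $A:\omega\to\bar k$ determined by some $T$-family in $\mathcal L^0(\omega)$. *)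

(* Defs.v *)
From mathcomp Require Import all_boot finmap.
From mathcomp Require Import boolp classical_sets.
Set Implicit Arguments.
Unset Strict Implicit.
Unset Printing Implicit Defensive.
Local Open Scope classical_set_scope.

(* Kleene's class of total functions, with minimization of regular functions
   only: in [rec_mu] the existence of [h] says that every search succeeds. *)
Inductive recursive : forall n, (n.-tuple nat -> nat) -> Prop :=
| rec_zero n : recursive (fun _ : n.-tuple nat => 0)
| rec_succ : recursive (fun v : 1.-tuple nat => (thead v).+1)
| rec_proj n (i : 'I_n) : recursive (fun v => tnth v i)
| rec_comp m n (f : m.-tuple nat -> nat) (g : 'I_m -> n.-tuple nat -> nat) :
    recursive f -> (forall i, recursive (g i)) ->
    recursive (fun v => f [tuple g i v | i < m])
| rec_prim n (f : n.-tuple nat -> nat) (g : n.+2.-tuple nat -> nat)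
    (h : n.+1.-tuple nat -> nat) :
    recursive f -> recursive g ->
    (forall v : n.-tuple nat, h [tuple of 0 :: v] = f v) ->
    (forall x (v : n.-tuple nat),
       h [tuple of x.+1 :: v] = g [tuple of x :: h [tuple of x :: v] :: v]) ->
    recursive h
| rec_mu n (f : n.+1.-tuple nat -> nat) (h : n.-tuple nat -> nat) :
    recursive f ->
    (forall v, f [tuple of h v :: v] = 0) ->
    (forall v x, x < h v -> f [tuple of x :: v] <> 0) ->
    recursive h.

Definition recursive_rel n (R : set (n.-tuple nat)) : Prop :=
  recursive (fun v => nat_of_bool (v \in R)).

(* The Pi relations of level [l] enter as the complements of those of
   [sigma0 l]. *)
Fixpoint sigma0 (l n : nat) : set (set (n.-tuple nat)) :=
  if l is l'.+1 then
    [set [set v : n.-tuple nat | exists x, (~` R) [tuple of x :: v]] | R in @sigma0 l' n.+1]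
  else [set R | recursive_rel R].

(* Indexing is shifted: [SigmaN n] is the level 1+n. *)
Definition SigmaN (n : nat) : set (set nat) :=
  [set S | sigma0 n.+1 [set v : 1.-tuple nat | S (thead v)]].

Definition Lbase (n j : nat) (Y : set nat) : set (set nat) :=
  [set Y `&` S | S in SigmaN (n + j)].

Record normal_tree := NormalTree {
  nodes :> {fset seq nat};
  nodes_neq0 : nodes != fset0;
  nodes_prefix : forall s t : seq nat, prefix s t -> t \in nodes -> s \in nodes;
  nodes_normal : forall (s : seq nat) (i : nat),
    rcons s i.+1 \in nodes -> rcons s i \in nodes }.

Record qtree (Q : Type) := QTree { tree : normal_tree; label : tree -> Q }.

Definition node_le (T : normal_tree) (s t : T) : bool := prefix (val s) (val t).
Definition node_lt (T : normal_tree) (s t : T) : bool :=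
  node_le s t && (s != t).

Definition qtree_le (Q : Type) (le : Q -> Q -> Prop) (T V : qtree Q) : Prop :=
  exists f : tree T -> tree V,
    (forall s t, node_le s t -> node_le (f s) (f t)) /\
    (forall s, le (label s) (label (f s))).

Definition qtree_map (P Q : Type) (g : P -> Q) (T : qtree P) : qtree Q :=
  QTree (fun s : tree T => g (label s)).

Lemma single_neq0 : [fset [::]]%fset != fset0 :> {fset seq nat}.
Proof. by apply/fset0Pn; exists [::]; rewrite in_fset1. Qed.

Lemma single_prefix (s t : seq nat) :
  prefix s t -> t \in [fset [::]]%fset -> s \in [fset [::]]%fset.
Proof. by rewrite !in_fset1 => + /eqP t0; rewrite t0 prefixs0. Qed.

Lemma single_normal (s : seq nat) (i : nat) :
  rcons s i.+1 \in [fset [::]]%fset -> rcons s i \in [fset [::]]%fset.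
Proof. by rewrite in_fset1; case: s. Qed.

Definition single_tree : normal_tree :=
  NormalTree single_neq0 single_prefix single_normal.

Definition qtree_single (Q : Type) (q : Q) : qtree Q :=
  QTree (fun _ : single_tree => q).

(* [Some k] stands for the finite number k and [None] for omega. *)
Definition two_le (k : option nat) : Prop := if k is Some n then 2 <= n else True.
Definition kbar (k : option nat) : Type := if k is Some n then 'I_n else nat.

Fixpoint iter_tree (k : option nat) (m : nat) : Type :=
  if m is m'.+1 then qtree (iter_tree k m') else kbar k.

Fixpoint iter_le (k : option nat) (m : nat) :
    iter_tree k m -> iter_tree k m -> Prop :=
  match m with
  | 0 => fun i j => i = j
  | m'.+1 => qtree_le (@iter_le k m')
  end.

Fixpoint embed (k : option nat) (m : nat) : iter_tree k m -> iter_tree k m.+1 :=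
  match m with
  | 0 => fun i => qtree_single i
  | m'.+1 => qtree_map (@embed k m')
  end.

Fixpoint embed_add (k : option nat) (m d : nat) (T : iter_tree k m) :
    iter_tree k (d + m) :=
  match d with
  | 0 => T
  | d'.+1 => embed (embed_add d' T)
  end.

Definition embed_to (k : option nat) (m p : nat) (le_mp : m <= p)
    (T : iter_tree k m) : iter_tree k p :=
  ecast i (iter_tree k i) (subnK le_mp) (embed_add (p - m) T).

Definition omega_tree (k : option nat) : Type := {m : nat & iter_tree k m}.

Definition omega_le (k : option nat) (T V : omega_tree k) : Prop :=
  let m := projT1 T in let n := projT1 V in
  iter_le (embed_to (leq_maxl m n) (projT2 T))
          (embed_to (leq_maxr m n) (projT2 V)).

Definition tilde (T : normal_tree) (U : T -> set nat) (s : T) : set nat :=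
  U s `\` \bigcup_(t in [set t | node_lt s t]) U t.

(* The raw data of a family; [is_family] adds the conditions. *)
Fixpoint family_data (k : option nat) (m : nat) : iter_tree k m -> Type :=
  match m with
  | 0 => fun _ => set nat
  | m'.+1 => fun T : qtree (iter_tree k m') =>
      ((tree T -> set nat) * (forall s : tree T, family_data (label s)))%type
  end.

Fixpoint is_family (k : option nat) (m n : nat) (Y : set nat) :
    forall T : iter_tree k m, family_data T -> Prop :=
  match m with
  | 0 => fun _ F => F = Y
  | m'.+1 => fun (T : qtree (iter_tree k m')) F =>
      [/\ forall s : tree T, Lbase n 0 Y (F.1 s),
          forall s : tree T, val s = [::] -> F.1 s = Y,
          forall s t : tree T, node_le s t -> F.1 t `<=` F.1 s
        & forall s : tree T, is_family n.+1 (tilde F.1 s) (F.2 s)]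
  end.

(* Partitions of a set [Y] are represented by total functions [A] on [nat]:
   if [F] is a family over [Y], [determines F A] says that the restriction of
   [A] to [Y] is the partition determined by [F].  It constrains [A] on [Y]
   only.  Components of incomparable nodes may overlap, and then a family need
   not determine any partition. *)
Fixpoint determines (k : option nat) (m : nat) :
    forall T : iter_tree k m, family_data T -> (nat -> kbar k) -> Prop :=
  match m with
  | 0 => fun (i : kbar k) (Y : set nat) A => forall x, Y x -> A x = i
  | m'.+1 => fun (T : qtree (iter_tree k m')) F A =>
      forall s : tree T, determines (F.2 s) A
  end.

Definition SigmaT (k : option nat) (T : omega_tree k) : set (nat -> kbar k) :=
  [set A | exists F : family_data (projT2 T),
             is_family 0 [set: nat] F /\ determines F A].

(* Main.v *)
(* Fix [T]. The partitions in Sigma(N,T) have a universal member [A]: every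
   [B] in Sigma(N,T) is [x |-> A <e,x>] for some [e]. Suppose that [A] also
   belongs to Sigma(N,V) and that [T] is not below [V]. Then so does the diagonal
   [x |-> A <x,x>], and it suffices to find [B] in Sigma(N,T) that differs from
   it at every point: for its index [e] this fails at [x = e].

   A family can be reduced, using the uniformization property of the Sigma
   classes, so that the components of incomparable nodes are disjoint; each [x]
   then determines a node of [V], to which it climbs along a path as it is
   enumerated. As there is no monotone map from [T] to [V], there is a monotone
   [g : V -> T] with label(g s) not below label(s). Putting [x] at the node [g s]
   of [T] when [V] puts it at [s] gives a family for [T], and [B] on the
   corresponding component is obtained one level higher by induction on the depth
   of nesting. *)
Require Import Defs.
From mathcomp Require Import all_boot finmap.
From mathcomp Require Import boolp classical_sets.
From mathcomp Require Import zify.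
Set Implicit Arguments.
Unset Strict Implicit.
Unset Printing Implicit Defensive.
Local Open Scope classical_set_scope.

(** * Recursive functions of one variable *)

Definition recursive1 (f : nat -> nat) : Prop :=
  recursive (fun v : 1.-tuple nat => f (thead v)).

Definition recursive2 (f : nat -> nat -> nat) : Prop :=
  recursive (fun v : 2.-tuple nat => f (tnth v ord0) (tnth v ord_max)).

Lemma recursive_ext n (f g : n.-tuple nat -> nat) :
  f =1 g -> recursive f -> recursive g.
Proof. by move=> /funext ->. Qed.

Lemma recursive_comp1 n f (g : n.-tuple nat -> nat) :
  recursive1 f -> recursive g -> recursive (fun v => f (g v)).
Proof.
move=> hf hg; apply: recursive_ext (rec_comp hf (fun _ : 'I_1 => hg)) => v.
by rewrite /thead tnth_mktuple.
Qed.

Lemma recursive_comp2 n f (g h : n.-tuple nat -> nat) :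
  recursive2 f -> recursive g -> recursive h ->
  recursive (fun v => f (g v) (h v)).
Proof.
move=> hf hg hh.
have hgh (i : 'I_2) : recursive (if i == ord0 then g else h) by case: ifP.
apply: recursive_ext (rec_comp hf hgh) => v.
by rewrite !tnth_mktuple.
Qed.

Lemma recursive1_comp f g :
  recursive1 f -> recursive1 g -> recursive1 (fun x => f (g x)).
Proof. exact: recursive_comp1. Qed.

Lemma recursive1_comp2 f g h :
  recursive2 f -> recursive1 g -> recursive1 h ->
  recursive1 (fun x => f (g x) (h x)).
Proof. exact: recursive_comp2. Qed.

Lemma recursive1_id : recursive1 id.
Proof. exact: (rec_proj ord0). Qed.

Lemma recursive1_succ f : recursive1 f -> recursive1 (fun x => (f x).+1).
Proof. exact: (recursive1_comp rec_succ). Qed.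

Lemma recursive_const n c : recursive (fun _ : n.-tuple nat => c).
Proof.
elim: c => [|c ih]; first exact: rec_zero.
exact: (recursive_comp1 rec_succ ih).
Qed.

Lemma recursive1_const c : recursive1 (fun=> c).
Proof. exact: recursive_const. Qed.

Lemma recursive2_prim (f g : nat -> nat -> nat) :
  recursive1 (f 0) ->
  recursive (fun v : 3.-tuple nat => g (tnth v ord0) (tnth v (@Ordinal 3 1 isT))) ->
  (forall x y, f x.+1 y = g x (f x y)) ->
  recursive2 f.
Proof.
move=> h0 hg hS; apply: (rec_prim h0 hg) => [v|x v].
  by rewrite !(tnth_nth 0) /= /thead (tnth_nth 0).
by rewrite !(tnth_nth 0) /= hS.
Qed.

Lemma recursive2_add : recursive2 addn.
Proof.
apply: (recursive2_prim (g := fun _ r => r.+1)) => //.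
  exact: recursive1_id.
exact: recursive_comp1 rec_succ (rec_proj _).
Qed.

Lemma recursive2_swap f : recursive2 f -> recursive2 (fun x y => f y x).
Proof. by move=> hf; apply: (recursive_comp2 hf); apply: rec_proj. Qed.

Lemma recursive1_pred : recursive1 predn.
Proof.
have h : recursive2 (fun x _ => x.-1).
  apply: (recursive2_prim (g := fun x _ => x)) => //.
    exact: recursive1_const.
  exact: rec_proj.
exact: (recursive1_comp2 h recursive1_id recursive1_id).
Qed.

Lemma recursive2_sub : recursive2 subn.
Proof.
apply: (@recursive2_swap (fun x y => y - x)).
apply: (recursive2_prim (g := fun _ r => r.-1)).
- by apply: recursive_ext recursive1_id => v; rewrite subn0.
- exact: recursive_comp1 recursive1_pred (rec_proj _).
- by move=> x y; rewrite subnS.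
Qed.

(** * The Cantor pairing function *)

Fixpoint tri (n : nat) : nat := if n is n'.+1 then tri n' + n else 0.

Lemma recursive1_tri : recursive1 tri.
Proof.
have h : recursive2 (fun x _ => tri x).
  apply: (recursive2_prim (g := fun x r => r + x.+1)) => //.
    exact: recursive1_const.
  apply: (recursive_comp2 recursive2_add); first exact: rec_proj.
  exact: recursive_comp1 rec_succ (rec_proj _).
exact: (recursive1_comp2 h recursive1_id recursive1_id).
Qed.

Lemma leq_tri n : n <= tri n.
Proof. by elim: n => //= n; lia. Qed.

Lemma tri_mono m n : m <= n -> tri m <= tri n.
Proof.
elim: n => [|n ih]; first by rewrite leqn0 => /eqP ->.
by rewrite leq_eqVlt ltnS => /predU1P[-> //|/ih] /=; lia.
Qed.

Lemma tri_inv_ex z : exists w, z < tri w.+1.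
Proof. by exists z; have := leq_tri z.+1; lia. Qed.

(** The number of the diagonal on which [z] lies. *)
Definition tri_inv (z : nat) : nat := ex_minn (tri_inv_ex z).

Lemma recursive1_tri_inv : recursive1 tri_inv.
Proof.
(* This difference vanishes exactly when [z < tri w.+1], so minimization finds [tri_inv z]. *)
have h : recursive2 (fun w z => z.+1 - tri w.+1).
  apply: (recursive_comp2 recursive2_sub).
    exact: recursive_comp1 rec_succ (rec_proj _).
  apply: (recursive_comp1 recursive1_tri).
  exact: recursive_comp1 rec_succ (rec_proj _).
apply: (rec_mu h) => [v|v w]; rewrite !(tnth_nth 0) /= /thead (tnth_nth 0);
  rewrite /tri_inv; case: ex_minnP => w' hw' min /=.
  by apply/eqP; rewrite subn_eq0.
by move=> lt_w /eqP; rewrite subn_eq0 => /min; lia.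
Qed.

(** Cantor's pairing: [x + y] numbers the diagonal and [x] is the place on it. *)
Definition pair (x y : nat) : nat := tri (x + y) + x.
Definition fst_of (z : nat) : nat := z - tri (tri_inv z).
Definition snd_of (z : nat) : nat := tri_inv z - fst_of z.

Lemma tri_inv_pair x y : tri_inv (pair x y) = x + y.
Proof.
rewrite /tri_inv /pair; case: ex_minnP => w hw min.
apply/eqP; rewrite eqn_leq min; last by rewrite /=; lia.
rewrite leqNgt; apply/negP => /tri_mono; lia.
Qed.

Lemma fst_pair x y : fst_of (pair x y) = x.
Proof. by rewrite /fst_of tri_inv_pair /pair addKn. Qed.

Lemma snd_pair x y : snd_of (pair x y) = y.
Proof. by rewrite /snd_of fst_pair tri_inv_pair addKn. Qed.

Lemma pair_eta z : pair (fst_of z) (snd_of z) = z.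
Proof.
have : tri (tri_inv z) <= z < tri (tri_inv z).+1.
  rewrite /tri_inv; case: ex_minnP => -[|w] hw min; first by rewrite hw.
  by rewrite hw andbT leqNgt; apply/negP => /min; lia.
by move=> /andP[h1 /= h2]; rewrite /pair /snd_of /fst_of subnKC; lia.
Qed.

Definition pairE := (fst_pair, snd_pair).

Lemma recursive2_pair : recursive2 pair.
Proof.
apply: (recursive_comp2 recursive2_add); last exact: rec_proj.
exact: (recursive_comp1 recursive1_tri recursive2_add).
Qed.

Lemma recursive1_fst_of : recursive1 fst_of.
Proof.
apply: (recursive1_comp2 recursive2_sub recursive1_id).
exact: (recursive1_comp recursive1_tri recursive1_tri_inv).
Qed.

Lemma recursive1_snd_of : recursive1 snd_of.
Proof.
exact: (recursive1_comp2 recursive2_sub recursive1_tri_inv recursive1_fst_of).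
Qed.

Lemma recursive1_pair f g :
  recursive1 f -> recursive1 g -> recursive1 (fun x => pair (f x) (g x)).
Proof. exact: recursive1_comp2 recursive2_pair. Qed.

Lemma recursive1_fst f : recursive1 f -> recursive1 (fun x => fst_of (f x)).
Proof. exact: recursive1_comp recursive1_fst_of. Qed.

Lemma recursive1_snd f : recursive1 f -> recursive1 (fun x => snd_of (f x)).
Proof. exact: recursive1_comp recursive1_snd_of. Qed.

(** Packing counter, previous value and parameter into one number keeps the step function unary. *)
Lemma recursive1_prim f g a b :
  recursive1 f -> recursive1 g -> recursive1 a -> recursive1 b ->
  recursive1 (fun x => nat_rec (fun=> nat) (f (b x))
    (fun i r => g (pair i (pair r (b x)))) (a x)).
Proof.
move=> hf hg; apply: (@recursive1_comp2 (fun n y => nat_rec (fun=> nat) (f y)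
  (fun i r => g (pair i (pair r y))) n)).
have hg' : recursive (fun v : 3.-tuple nat =>
    g (pair (tnth v ord0) (pair (tnth v (@Ordinal 3 1 isT)) (tnth v ord_max)))).
  apply: (recursive_comp1 hg).
  apply: (recursive_comp2 recursive2_pair); first exact: rec_proj.
  by apply: (recursive_comp2 recursive2_pair); exact: rec_proj.
apply: (rec_prim hf hg') => [v|x v]; rewrite !(tnth_nth 0) //=.
by rewrite /thead (tnth_nth 0).
Qed.

(** A recursion on [f x] whose step ignores the previous value. *)
Lemma recursive1_if f g h :
  recursive1 f -> recursive1 g -> recursive1 h ->
  recursive1 (fun x => if f x == 0 then g x else h x).
Proof.
move=> hf hg hh.
have hh' := recursive1_comp hh (recursive1_comp recursive1_snd_of recursive1_snd_of).
apply: recursive_ext (recursive1_prim hg hh' hf recursive1_id) => v.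
by case: (f _) => //= ?; rewrite !pairE.
Qed.

Lemma recursive1_iter f a b :
  recursive1 f -> recursive1 a -> recursive1 b ->
  recursive1 (fun x => iter (a x) f (b x)).
Proof.
move=> hf ha hb.
have hf' := recursive1_comp hf (recursive1_comp recursive1_fst_of recursive1_snd_of).
apply: recursive_ext (recursive1_prim recursive1_id hf' ha hb) => v.
by elim: (a _) => //= i ->; rewrite !pairE.
Qed.

(** * Programs *)

(** The successor keeps nonempty stacks apart from the empty one, [0]. *)
Definition push (i a K : nat) : nat := (pair (pair i a) K).+1.

Definition instr (z : nat) : nat := fst_of (fst_of (fst_of z).-1).
Definition arg (z : nat) : nat := snd_of (fst_of (fst_of z).-1).
Definition rest (z : nat) : nat := snd_of (fst_of z).-1.
Definition value (z : nat) : nat := snd_of z.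

(* A state [pair K x] is a value [x] together with a stack [K] of instructions
   still to be applied to it; the empty stack is [0], and states with empty
   stack are final.  Instructions 0 to 4 compute zero, successor, predecessor
   and the projections; [5] is composition, [6] pairing, [9] the loop that runs
   its body until the first component of the value is [0].  Instructions 7 and
   8 are the intermediate stages of a pairing. *)
Definition step (z : nat) : nat :=
  let i := instr z in let a := arg z in let K := rest z in let x := value z in
  if fst_of z == 0 then z
  else if i == 0 then pair K 0
  else if i.-1 == 0 then pair K x.+1
  else if i.-2 == 0 then pair K x.-1
  else if i.-2.-1 == 0 then pair K (fst_of x)
  else if i.-2.-2 == 0 then pair K (snd_of x)
  else if i.-2.-2.-1 == 0 then
    pair (pair (snd_of a) (pair (fst_of a) K).+1).+1 x
  else if i.-2.-2.-2 == 0 then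
    pair (pair (fst_of a) (push 7 (pair (snd_of a) x) K)).+1 x
  else if i.-2.-2.-2.-1 == 0 then
    pair (pair (fst_of a) (push 8 x K)).+1 (snd_of a)
  else if i.-2.-2.-2.-2 == 0 then pair K (pair a x)
  else if fst_of x == 0 then pair K x
  else pair (pair a (push 9 a K)).+1 x.

Ltac rec1 := repeat first
  [ exact: recursive1_id | exact: recursive1_const
  | assumption
  | apply: recursive1_pair | apply: recursive1_succ
  | apply: recursive1_fst | apply: recursive1_snd
  | apply: (recursive1_comp recursive1_pred)
  | apply: recursive1_if ].

Lemma recursive1_step : recursive1 step.
Proof. by rewrite /step /instr /arg /rest /value /push; rec1. Qed.

Definition reach (z z' : nat) : Prop := exists s, iter s step z = z'.

Lemma reach_refl z : reach z z.
Proof. by exists 0. Qed.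

Lemma reach_trans y x z : reach x y -> reach y z -> reach x z.
Proof. by move=> [s <-] [t <-]; exists (t + s); rewrite iterD. Qed.

Lemma reach_step x z : reach (step x) z -> reach x z.
Proof. by move=> [s <-]; exists s.+1; rewrite iterSr. Qed.

(** Quantifying over the remaining stack [K] makes programs composable. *)
Definition runs (p : nat) (f : nat -> nat) : Prop :=
  forall K x, reach (pair (pair p K).+1 x) (pair K (f x)).

Definition programmable (f : nat -> nat) : Prop := exists p, runs p f.

Ltac exec :=
  apply: reach_step; rewrite /step /instr /arg /rest /value /push !pairE /= ?pairE.

Lemma programmable_ext f g : f =1 g -> programmable f -> programmable g.
Proof. by move=> /funext ->. Qed.

Lemma programmable_zero : programmable (fun=> 0).
Proof. by exists (pair 0 0) => K x; exec; exact: reach_refl. Qed.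

Lemma programmable_succ : programmable succn.
Proof. by exists (pair 1 0) => K x; exec; exact: reach_refl. Qed.

Lemma programmable_pred : programmable predn.
Proof. by exists (pair 2 0) => K x; exec; exact: reach_refl. Qed.

Lemma programmable_fst : programmable fst_of.
Proof. by exists (pair 3 0) => K x; exec; exact: reach_refl. Qed.

Lemma programmable_snd : programmable snd_of.
Proof. by exists (pair 4 0) => K x; exec; exact: reach_refl. Qed.

Lemma programmable_comp f g :
  programmable f -> programmable g -> programmable (fun x => f (g x)).
Proof.
move=> [p hp] [q hq]; exists (pair 5 (pair p q)) => K x; exec.
exact: reach_trans (hq _ _) (hp _ _).
Qed.

(** Instruction 7 keeps [q] and the input while [p] runs; instruction 8 keeps the result of [p]
    while [q] runs. *)
Lemma programmable_pair f g :
  programmable f -> programmable g -> programmable (fun x => pair (f x) (g x)).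
Proof.
move=> [p hp] [q hq]; exists (pair 6 (pair p q)) => K x; exec.
apply: reach_trans (hp _ _) _; exec.
apply: reach_trans (hq _ _) _; exec.
exact: reach_refl.
Qed.

Lemma programmable_id : programmable id.
Proof.
apply: programmable_ext (programmable_pair programmable_fst programmable_snd).
exact: pair_eta.
Qed.

(** The loop tests before each run of its body, and [h x] is the first state that passes the
    test. *)
Lemma programmable_while f init h :
  programmable f -> programmable init ->
  (forall x, exists n, [/\ h x = iter n f (init x), fst_of (h x) = 0 &
    forall i, i < n -> fst_of (iter i f (init x)) <> 0]) ->
  programmable h.
Proof.
move=> [p hp] [q hq] hh; exists (pair 5 (pair (pair 9 p) q)) => K x; exec.
apply: reach_trans (hq _ _) _.
have [n [-> end_n run_n]] : exists n, [/\ h x = iter n f (init x),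
    fst_of (iter n f (init x)) = 0 &
    forall i, i < n -> fst_of (iter i f (init x)) <> 0].
  by have [n [e]] := hh x; rewrite e => *; exists n.
(* Induction on the number of iterations left, from an arbitrary state [y]. *)
elim: n {hq hh} (init x) end_n run_n => [|n ih] y end_n run_n; exec.
  by rewrite end_n; exact: reach_refl.
have /eqP/negbTE-> := run_n 0 isT.
rewrite -/iter -iterS iterSr; apply: reach_trans (hp _ _) (ih _ _ _).
  by rewrite -iterSr.
by move=> i lt_in; rewrite -iterSr; apply: run_n.
Qed.

Lemma programmable_prim f g h :
  programmable f -> programmable g ->
  (forall v, h (pair 0 v) = f v) ->
  (forall x v, h (pair x.+1 v) = g (pair x (pair (h (pair x v)) v))) ->
  programmable h.
Proof.
move=> hf hg h0 hS.
(* A loop state consists of a countdown, the current [i], the value of [h] at [i], and the parameter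
   [v]. *)
pose init x := pair (fst_of x) (pair 0 (pair (f (snd_of x)) (snd_of x))).
pose body s := pair (fst_of s).-1
  (pair (fst_of (snd_of s)).+1
     (pair (g (snd_of s)) (snd_of (snd_of (snd_of s))))).
have bodyE n v i c : c <= n ->
    iter c body (pair n (pair i (pair (h (pair i v)) v))) =
    pair (n - c) (pair (i + c) (pair (h (pair (i + c) v)) v)).
  elim: c => [|c ih] le_cn; first by rewrite subn0 addn0.
  by rewrite iterS ih 1?ltnW // /body !pairE addnS hS subnS.
pose loop x := iter (fst_of x) body (init x).
have hinit : programmable init.
  apply: programmable_pair; first exact: programmable_fst.
  apply: programmable_pair; first exact: programmable_zero.
  apply: programmable_pair; last exact: programmable_snd.
  exact: programmable_comp hf programmable_snd.
have hbody : programmable body.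
  apply: programmable_pair.
    exact: programmable_comp programmable_pred programmable_fst.
  apply: programmable_pair.
    apply: programmable_comp programmable_succ _.
    exact: programmable_comp programmable_fst programmable_snd.
  apply: programmable_pair; first exact: programmable_comp hg programmable_snd.
  do 2 apply: programmable_comp programmable_snd _.
  exact: programmable_snd.
have iter_fst c s : fst_of (iter c body s) = fst_of s - c.
  by elim: c => [|c ih]; rewrite ?subn0 // iterS /body !pairE ih subnS.
have hloop : programmable loop.
  apply: programmable_while hbody hinit _ => x; exists (fst_of x); split=> //.
    by rewrite iter_fst /init pairE subnn.
  by move=> i lt_i; rewrite iter_fst /init pairE; lia.
apply: (@programmable_ext (fun x => fst_of (snd_of (snd_of (loop x))))) => [x|].
  by rewrite /loop /init -h0 bodyE // !pairE add0n pair_eta.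
apply: programmable_comp programmable_fst _.
do 2 apply: programmable_comp programmable_snd _.
exact: hloop.
Qed.

Lemma programmable_mu f h :
  programmable f -> (forall v, f (pair (h v) v) = 0) ->
  (forall v x, x < h v -> f (pair x v) <> 0) -> programmable h.
Proof.
move=> hf h0 hmin.
(* The value of [f] at the current candidate is stored in front, where the loop tests it. *)
pose init v := pair (f (pair 0 v)) (pair 0 v).
pose next s := pair (fst_of (snd_of s)).+1 (snd_of (snd_of s)).
pose body s := pair (f (next s)) (next s).
have bodyE c v : iter c body (init v) = pair (f (pair c v)) (pair c v).
  by elim: c => // c ih; rewrite iterS ih /body /next !pairE.
have hnext : programmable next.
  apply: programmable_pair.
    apply: programmable_comp programmable_succ _.
    exact: programmable_comp programmable_fst programmable_snd.
  exact: programmable_comp programmable_snd programmable_snd.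
have hbody : programmable body.
  exact: programmable_pair (programmable_comp hf hnext) hnext.
have h0v : programmable (fun v => pair 0 v).
  exact: programmable_pair programmable_zero programmable_id.
have hinit : programmable init.
  exact: programmable_pair (programmable_comp hf h0v) h0v.
have hloop : programmable (fun v => iter (h v) body (init v)).
  apply: programmable_while hbody hinit _ => v; exists (h v); split=> //.
    by rewrite bodyE pairE.
  by move=> i lt_i; rewrite bodyE pairE; apply: hmin.
apply: (programmable_ext _ (programmable_comp programmable_fst
  (programmable_comp programmable_snd hloop))) => v.
by rewrite bodyE !pairE.
Qed.

(** * Tuples coded by single numbers *)

Fixpoint decode (n z : nat) : n.-tuple nat :=
  if n is n'.+1 then [tuple of fst_of z :: decode n' (snd_of z)] else [tuple].

(** Since [decode] drops the tail left after [n] components, it inverts [encode] on one side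
    only. *)
Fixpoint encode (s : seq nat) : nat :=
  if s is x :: s' then pair x (encode s') else 0.

Lemma decode_encode n (v : n.-tuple nat) : decode n (encode v) = v.
Proof.
elim: n v => [|n ih] v /=; first by rewrite [RHS]tuple0; exact: val_inj.
case/tupleP: v => x v; apply: val_inj => /=.
by rewrite !pairE ih.
Qed.

Lemma tnth_decode n (i : 'I_n) z : tnth (decode n z) i = fst_of (iter i snd_of z).
Proof.
elim: n i z => [[] //|n ih] i z /=.
case: (unliftP ord0 i) => [j ->|->].
  by rewrite tnthS ih lift0 iterSr.
by rewrite tnth0.
Qed.

Lemma decode1 z : thead (decode 1 z) = fst_of z.
Proof. by rewrite /thead tnth_decode. Qed.

(** Induction on the derivation, each clause being matched by instructions or a loop. The number of
    the program later serves as an index in [Sig_universal]. *)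
Lemma recursive_programmable n (f : n.-tuple nat -> nat) :
  recursive f -> programmable (fun z => f (decode n z)).
Proof.
elim=> {n f}.
- by move=> n; exact: programmable_zero.
- apply: (@programmable_ext (fun z => (fst_of z).+1)) => [z|].
    by rewrite decode1.
  exact: programmable_comp programmable_succ programmable_fst.
- move=> n i.
  apply: (@programmable_ext (fun z => fst_of (iter i snd_of z))) => [z|].
    by rewrite tnth_decode.
  apply: (programmable_comp programmable_fst).
  elim: (nat_of_ord i) => [|j ih]; first exact: programmable_id.
  exact: (programmable_comp programmable_snd ih).
- move=> m n f g _ hf _ hg.
  (* The programs of the [g i] are paired successively into one that computes the code of the whole
     tuple. *)
  have henc : programmable (fun z => encode [tuple g i (decode n z) | i < m]).
    rewrite /=; elim: (enum 'I_m) => [|i s ih]; first exact: programmable_zero.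
    exact: (programmable_pair (hg i) ih).
  apply: (programmable_ext _ (programmable_comp hf henc)) => z.
  by rewrite decode_encode.
- move=> n f g h _ hf _ hg h0 hS.
  apply: (programmable_prim hf hg) => [z|x z]; rewrite /= ?pairE ?h0 ?hS //.
- move=> n f h _ hf h0 hmin; apply: (programmable_mu hf) => [z|z x]; rewrite /= !pairE.
    exact: h0.
  exact: hmin.
Qed.

Lemma recursive1_programmable f : recursive1 f -> programmable f.
Proof.
move=> /recursive_programmable hf.
have h0 := programmable_comp hf (programmable_pair programmable_id programmable_zero).
by apply: (programmable_ext _ h0) => x; rewrite decode1 pairE.
Qed.

(** Together with [recursive_encode] this reduces relations of any arity to sets of numbers. *)
Lemma recursive_decode n (f : n.-tuple nat -> nat) :
  recursive f -> recursive1 (fun z => f (decode n z)).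
Proof.
move=> hf; have hi (i : 'I_n) : recursive1 (fun z => fst_of (iter i snd_of z)).
  apply: recursive1_fst.
  apply: (recursive1_iter recursive1_snd_of (recursive1_const _)).
  exact: recursive1_id.
apply: recursive_ext (rec_comp hf hi) => v.
by congr f; apply: eq_from_tnth => i; rewrite tnth_mktuple tnth_decode.
Qed.

Lemma recursive_encode n : recursive (fun v : n.-tuple nat => encode v).
Proof.
have h (s : seq 'I_n) : recursive (fun v : n.-tuple nat => encode (map (tnth v) s)).
  elim: s => [|i s ih]; first exact: rec_zero.
  exact: (recursive_comp2 recursive2_pair (rec_proj i) ih).
by apply: recursive_ext (h (enum 'I_n)) => v; rewrite map_tnth_enum.
Qed.

(** * The arithmetical hierarchy *)

(* [sigma0 l] for unary relations, with tuples coded by [pair]. *)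
Fixpoint Sig (l : nat) : set (set nat) :=
  if l is l'.+1 then [set [set x | exists y, ~ R (pair y x)] | R in Sig l']
  else [set A | recursive1 (fun x => nat_of_bool (x \in A))].

Lemma Sig_ext l (A B : set nat) : (forall x, A x <-> B x) -> Sig l A -> Sig l B.
Proof. by move=> /predeqP ->. Qed.

Lemma SigS l (A : set nat) :
  Sig l.+1 A <-> exists2 R, Sig l R & forall x, A x <-> exists y, ~ R (pair y x).
Proof.
split=> [[R hR <-]|[R hR hA]]; first by exists R.
by exists R => //; apply/esym/predeqP.
Qed.

Lemma Sig0P (A : set nat) :
  Sig 0 A <-> exists2 f, recursive1 f & forall x, A x <-> f x = 0.
Proof.
split=> [hA|[f hf hA]].
  exists (fun x => if nat_of_bool (x \in A) == 0 then 1 else 0); first by rec1.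
  move=> x; case: (boolP (x \in A)); rewrite ?inE; first by [].
  by rewrite notin_setE.
rewrite /= (_ : (fun x => _) = fun x => if f x == 0 then 1 else 0); first by rec1.
apply/funext => x; case: eqP => hx; last by rewrite memNset // => /hA.
by rewrite mem_set //; apply/hA.
Qed.

Lemma Sig_preimage l (A : set nat) r :
  recursive1 r -> Sig l A -> Sig l [set x | A (r x)].
Proof.
elim: l A r => [|l ih] A r hr.
  move=> /Sig0P[f hf hA]; apply/Sig0P; exists (fun x => f (r x)); last first.
    by move=> x; exact: hA.
  exact: recursive1_comp hf hr.
move=> /SigS[R hR hA]; apply/SigS.
exists [set z | R (pair (fst_of z) (r (snd_of z)))].
  apply: (ih R) hR; rec1.
  exact: recursive1_comp hr recursive1_snd_of.
by move=> x /=; rewrite hA; split=> -[y]; exists y; move: p; rewrite !pairE.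
Qed.

Lemma SigC l (A : set nat) : Sig l A -> Sig l.+1 (~` A).
Proof.
move=> hA; apply/SigS; exists [set z | A (snd_of z)].
  exact: Sig_preimage recursive1_snd_of hA.
by move=> x; split=> [hx|[y]] /=; [exists 0|]; rewrite /= pairE.
Qed.

Lemma Sig0C (A : set nat) : Sig 0 A -> Sig 0 (~` A).
Proof.
move=> /Sig0P[f hf hA]; apply/Sig0P.
exists (fun x => if f x == 0 then 1 else 0); first by rec1.
by move=> x /=; rewrite hA; case: eqP.
Qed.

(** Recursive sets are closed under complement, which gives the first inclusion; the others follow
    by raising the level of the matrix [R]. *)
Lemma SigW l (A : set nat) : Sig l A -> Sig l.+1 A.
Proof.
elim: l A => [|l ih] A; first by move=> /Sig0C /SigC; rewrite setCK.
by move=> /SigS[R hR hA]; apply/SigS; exists R => //; apply: ih.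
Qed.

Lemma SigT l : Sig l setT.
Proof.
elim: l => [|l]; last exact: SigW.
by apply/Sig0P; exists (fun=> 0); first exact: recursive1_const.
Qed.

Lemma Sig_set0 l : Sig l set0.
Proof.
elim: l => [|l]; last exact: SigW.
by apply/Sig0P; exists (fun=> 1); first exact: recursive1_const.
Qed.

(** The matrix is negated, so each operation at one level uses the other at the level below; hence
    the joint induction. *)
Lemma SigIU l (A B : set nat) :
  Sig l A -> Sig l B -> Sig l (A `&` B) /\ Sig l (A `|` B).
Proof.
elim: l A B => [|l ih] A B.
  move=> /Sig0P[f hf hA] /Sig0P[g hg hB]; split; apply/Sig0P.
    exists (fun x => if f x == 0 then g x else 1); first by rec1.
    by move=> x; rewrite /setI /= hA hB; case: eqP => hx; [tauto|split=> // -[]].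
  exists (fun x => if f x == 0 then 0 else g x); first by rec1.
  by move=> x; rewrite /setU /= hA hB; case: eqP => hx; [split=> // _; left|tauto].
move=> /SigS[R hR hA] /SigS[Q hQ hB]; split; apply/SigS.
  exists ([set z | R (pair (fst_of (fst_of z)) (snd_of z))] `|`
          [set z | Q (pair (snd_of (fst_of z)) (snd_of z))]).
    by apply: (ih _ _ _ _).2; [apply: Sig_preimage hR|apply: Sig_preimage hQ]; rec1.
  move=> x; rewrite /setI /setU /= hA hB; split.
    move=> [[y hy] [y' hy']]; exists (pair y y'); rewrite !pairE; tauto.
  move=> [y]; rewrite !pairE not_orE => -[hy hy'].
  by split; [exists (fst_of y)|exists (snd_of y)].
exists (R `&` Q); first exact: (ih _ _ _ _).1.
move=> x; rewrite /setI /setU /= hA hB; split.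
  by move=> [[y hy]|[y hy]]; exists y; tauto.
by move=> [y /not_andP[hy|hy]]; [left|right]; exists y.
Qed.

Lemma SigI l (A B : set nat) : Sig l A -> Sig l B -> Sig l (A `&` B).
Proof. by move=> hA hB; apply: (SigIU hA hB).1. Qed.

Lemma SigU l (A B : set nat) : Sig l A -> Sig l B -> Sig l (A `|` B).
Proof. by move=> hA hB; apply: (SigIU hA hB).2. Qed.

Lemma Sig_exists l (A : set nat) :
  Sig l.+1 A -> Sig l.+1 [set x | exists y, A (pair y x)].
Proof.
move=> /SigS[R hR hA]; apply/SigS.
exists [set z | R (pair (fst_of (fst_of z)) (pair (snd_of (fst_of z)) (snd_of z)))].
  by apply: Sig_preimage hR; rec1.
move=> x /=; split=> [[y /hA[u hu]]|[w]]; first by exists (pair u y); rewrite !pairE.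
by rewrite !pairE => hw; exists (snd_of w); apply/hA; exists (fst_of w).
Qed.

(** One number holds the witnesses for all [t < s], so an existential quantifier can be moved in
    front of a bounded universal one. *)
Lemma finite_choice_code s (P : nat -> nat -> Prop) :
  (forall t, t < s -> exists y, P t y) ->
  exists c, forall t, t < s -> P t (fst_of (iter t snd_of c)).
Proof.
elim: s P => [|s ih] P hP; first by exists 0.
have [y hy] := hP 0 isT.
have [//|c hc] := ih (fun t => P t.+1) => [t|]; first exact: (hP t.+1).
by exists (pair y c) => -[|t] lt_t; rewrite ?iterSr pairE //; apply: hc.
Qed.

(** As with intersections and unions, the negated matrix exchanges the two bounded quantifiers, and
    they are treated together. *)
Lemma Sig_bounded l (A : set nat) : Sig l A ->
  Sig l [set z | forall t, t < fst_of z -> A (pair t (snd_of z))] /\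
  Sig l [set z | exists2 t, t < fst_of z & A (pair t (snd_of z))].
Proof.
elim: l A => [|l ih] A.
  have hall (B : set nat) : Sig 0 B ->
      Sig 0 [set z | forall t, t < fst_of z -> B (pair t (snd_of z))].
    move=> /Sig0P[f hf hB]; apply/Sig0P.
    (* [F] stays [0] as long as all values of [f] met so far are [0]. *)
    pose F z := nat_rec (fun=> nat) 0 (fun t r => if r == 0 then
      f (pair t (snd_of z)) else 1) (fst_of z).
    exists F.
      pose g u := if fst_of (snd_of u) == 0 then
        f (pair (fst_of u) (snd_of (snd_of (snd_of u)))) else 1.
      have hg : recursive1 g by rec1; apply: (recursive1_comp hf); rec1.
      apply: recursive_ext (recursive1_prim (recursive1_const 0) hg
        recursive1_fst_of recursive1_id) => v.
      rewrite /F /g; elim: (fst_of (thead v)) => //= t ->.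
      by rewrite !pairE.
    move=> z /=; rewrite /F; elim: (fst_of z) => [|s ih] //=.
    case: eqP ih => hs ih.
      rewrite -hB; split=> [h|h t]; first exact: h.
      rewrite ltnS leq_eqVlt => /predU1P[->//|]; exact: ih.2.
    split=> // h; case: hs; apply/ih => t lt_ts; apply: h; exact: ltnW.
  move=> hA; split; first exact: hall.
  apply: Sig_ext (Sig0C (hall _ (Sig0C hA))) => z /=.
  split=> [/existsNP[t /not_implyP[lt_t /contrapT]]|[t lt_t ht] /(_ t lt_t)//].
  by exists t.
move=> /SigS[R hR hA]; split; apply/SigS.
  (* The witness for [t] is read off as entry [t] of a code that is common to all [t]. *)
  pose B := [set u | R (pair (fst_of (iter (fst_of u) snd_of (fst_of (snd_of u))))
                             (pair (fst_of u) (snd_of (snd_of u))))].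
  have hB : Sig l B.
    apply: Sig_preimage hR; rec1.
    by apply: (recursive1_iter recursive1_snd_of); rec1.
  exists [set v | exists2 t, t < fst_of (snd_of v) &
                    B (pair t (pair (fst_of v) (snd_of (snd_of v))))].
    have h := (ih B hB).2.
    have hr : recursive1 (fun v => pair (fst_of (snd_of v))
      (pair (fst_of v) (snd_of (snd_of v)))) by rec1.
    by apply: Sig_ext (Sig_preimage hr h) => v; rewrite /= !pairE.
  move=> z /=; split.
    move=> hz; have [t /hz /hA //|c hc] := @finite_choice_code (fst_of z)
      (fun t y => ~ R (pair y (pair t (snd_of z)))).
    by exists c; rewrite !pairE => -[t /hc]; rewrite /B /= !pairE.
  move=> [c hc] t lt_t; apply/hA; exists (fst_of (iter t snd_of c)) => hR'.
  by apply: hc; rewrite !pairE; exists t => //; rewrite /B /= !pairE.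
(* Here the bounded and the unbounded existential quantifiers simply commute. *)
pose B := [set u | R (pair (fst_of (snd_of u)) (pair (fst_of u) (snd_of (snd_of u))))].
have hB : Sig l B by apply: Sig_preimage hR; rec1.
exists [set v | forall t, t < fst_of (snd_of v) ->
                    B (pair t (pair (fst_of v) (snd_of (snd_of v))))].
  have h := (ih B hB).1.
  have hr : recursive1 (fun v => pair (fst_of (snd_of v))
    (pair (fst_of v) (snd_of (snd_of v)))) by rec1.
  by apply: Sig_ext (Sig_preimage hr h) => v; rewrite /= !pairE.
move=> z /=; split.
  move=> [t lt_t /hA[y hy]]; exists y; rewrite !pairE => /(_ t lt_t).
  by rewrite /B /= !pairE.
move=> [y /existsNP[t /not_implyP[]]]; rewrite /B /= !pairE => lt_t hy.
by exists t => //; apply/hA; exists y.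
Qed.

(* Among all [i] with [W (pair i x)], the one whose membership has the least
   witness is selected. *)
Lemma Sig_uniformization l (W : set nat) : Sig l.+1 W ->
  exists W' : set nat, [/\ Sig l.+1 W', W' `<=` W,
    forall i x, W (pair i x) -> exists j, W' (pair j x) &
    forall i j x, W' (pair i x) -> W' (pair j x) -> i = j].
Proof.
move=> /SigS[R hR hW].
(* A candidate [c] codes a witness together with the index it belongs to; the least candidate
   wins. *)
pose Q c x := ~ R (pair (fst_of c) (pair (snd_of c) x)).
pose first c x := Q c x /\ forall d, d < c -> ~ Q d x.
have hfirst : Sig l.+1 [set z | first (fst_of z) (snd_of z)].
  apply: SigI.
    by apply: Sig_preimage (SigC hR); rec1.
  (* That no smaller candidate works says that [R] holds at each of them: a bounded quantifier over
     a set of level [l]. *)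
  have h : Sig l [set u |
      R (pair (fst_of (fst_of u)) (pair (snd_of (fst_of u)) (snd_of u)))].
    by apply: Sig_preimage hR; rec1.
  apply: Sig_ext (SigW (Sig_bounded h).1) => z.
  split=> hz d /hz; rewrite /Q /= !pairE; first by move=> ? [].
  exact: contrapT.
exists [set z | exists s, first (pair s (fst_of z)) (snd_of z)]; split.
- have hr : recursive1 (fun u => pair (pair (fst_of u) (fst_of (snd_of u)))
    (snd_of (snd_of u))) by rec1.
  apply: Sig_ext (Sig_exists (Sig_preimage hr hfirst)) => z /=.
  by split=> -[s]; exists s; move: p; rewrite !pairE.
- move=> z [s [+ _]]; rewrite /Q !pairE pair_eta => hs.
  by apply/hW; exists s.
- move=> i x /hW[s hs].
  have [|c /asboolP hc min] := @ex_minnP (fun c => `[< Q c x >]).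
    by exists (pair s i); apply/asboolP; rewrite /Q !pairE.
  exists (snd_of c), (fst_of c); rewrite !pairE pair_eta; split=> // d lt_d hd.
  by move: hd => /asboolP /min; rewrite leqNgt lt_d.
- move=> i j x [s]; rewrite !pairE => -[hs mins] [t []]; rewrite !pairE => ht mint.
  suff : pair s i = pair t j by move=> /(congr1 snd_of); rewrite !pairE.
  have [/mint//|/mins//|//] := ltngtP (pair s i) (pair t j).
Qed.

(** At level 1 an index is a program; each further level puts an existential quantifier before the
    complement of the previous universal set. *)
Lemma Sig_universal l : exists2 U : set nat, Sig l.+1 U &
  forall A, Sig l.+1 A -> exists e, forall x, A x <-> U (pair e x).
Proof.
elim: l => [|l [U hU univ]]; last first.
  exists [set z | exists y, ~ U (pair (fst_of z) (pair y (snd_of z)))].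
    apply/SigS; exists [set u | U (pair (fst_of (snd_of u))
        (pair (fst_of u) (snd_of (snd_of u))))].
      by apply: Sig_preimage hU; rec1.
    by move=> z; split=> -[y]; exists y; move: p; rewrite /= !pairE.
  move=> A /SigS[R /univ[e he] hA]; exists e => x; rewrite hA /= !pairE.
  by split=> -[y hy]; exists y; [rewrite -he|rewrite he].
(* The state after [s] steps of program [e] on input [z], started with nothing else on the stack. *)
pose state s e z := iter s step (pair (pair e 0).+1 z).
have state_halt s t e z : fst_of (state s e z) = 0 -> s <= t ->
    state t e z = state s e z.
  move=> h0 /subnK <-; rewrite /state iterD.
  by elim: (t - s) => // i; rewrite iterS => ->; rewrite /step h0.
(* Here [w] codes a number of steps and a witness: program [e] must halt within these steps with
   value [0]. *)
exists [set z | exists w,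
    fst_of (state (fst_of w) (fst_of z) (pair (snd_of w) (snd_of z))) = 0 /\
    snd_of (state (fst_of w) (fst_of z) (pair (snd_of w) (snd_of z))) = 0].
  have hst : recursive1 (fun u => state (fst_of (fst_of u)) (fst_of (snd_of u))
      (pair (snd_of (fst_of u)) (snd_of (snd_of u)))).
    by apply: (recursive1_iter recursive1_step); rec1.
  pose F u := if fst_of (state (fst_of (fst_of u)) (fst_of (snd_of u))
      (pair (snd_of (fst_of u)) (snd_of (snd_of u)))) == 0 then
    snd_of (state (fst_of (fst_of u)) (fst_of (snd_of u))
      (pair (snd_of (fst_of u)) (snd_of (snd_of u)))) else 1.
  have hF : recursive1 F by rewrite /F; rec1.
  apply/SigS; exists (~` [set u | F u = 0]).
    by apply: Sig0C; apply/Sig0P; exists F.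
  move=> z; split=> -[w hw]; exists w; move: hw.
    by rewrite /setC /F /= !pairE => -[-> ->] /=; tauto.
  by move=> /contrapT; rewrite /F /= !pairE; case: eqP.
move=> A /SigS[R /Sig0C/Sig0P[f /recursive1_programmable[e he] hR] hA].
exists e => x; rewrite hA /= !pairE; split=> [[y /hR hy]|[w [h0 h1]]].
  by have [s hs] := he 0 (pair y x); exists (pair s y);
    rewrite !pairE /state hs !pairE.
exists (snd_of w); apply/hR.
have [s hs] := he 0 (pair (snd_of w) x); rewrite -/(state _ _ _) in hs.
(* Two halting computations on the same input agree, as seen at the larger of their two times. *)
have e1 := state_halt _ (maxn s (fst_of w)) _ _ h0 (leq_maxr _ _).
have h0' : fst_of (state s e (pair (snd_of w) x)) = 0 by rewrite hs pairE.
have := state_halt _ (maxn s (fst_of w)) _ _ h0' (leq_maxl _ _).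
by rewrite e1 hs => /(congr1 snd_of); rewrite h1 pairE.
Qed.

Lemma sigma0_Sig l n (R : set (n.-tuple nat)) :
  sigma0 l R <-> Sig l [set z | R (decode n z)].
Proof.
elim: l n R => [|l ih] n R; split.
- by move=> /recursive_decode.
- move=> hR; apply: recursive_ext (recursive_comp1 hR (recursive_encode n)) => v.
  by congr nat_of_bool; apply/idP/idP; rewrite !inE /= decode_encode.
- move=> [Q /ih hQ <-]; apply/SigS; exists [set z | Q (decode n.+1 z)] => // z.
  by split=> -[y hy]; exists y; move: hy; rewrite /= !pairE.
move=> /SigS[Q hQ hR].
exists [set v : n.+1.-tuple nat | Q (pair (thead v) (encode (behead v)))].
  apply/ih.
  have hr : recursive1
      (fun z => pair (fst_of z) (encode (decode n (snd_of z)))).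
    apply: recursive1_pair; first exact: recursive1_fst_of.
    exact: (recursive1_comp (recursive_decode (recursive_encode n)) recursive1_snd_of).
  by apply: Sig_ext (Sig_preimage hr hQ) => z; rewrite /= theadE.
apply/predeqP => v; have := hR (encode v); rewrite /= decode_encode => ->.
by split=> -[y hy]; exists y; move: hy; rewrite /= theadE.
Qed.

Lemma SigmaNE n (S : set nat) : SigmaN n S <-> Sig n.+1 S.
Proof.
rewrite /SigmaN [X in X <-> _]/mkset sigma0_Sig; split=> hS; last first.
  by apply: Sig_ext (Sig_preimage recursive1_fst_of hS) => z; rewrite /= decode1.
have h : recursive1 (fun z => pair z 0) by rec1.
by apply: Sig_ext (Sig_preimage h hS) => z; rewrite /= decode1 pairE.
Qed.

Lemma Sig_bigcup l (I : finType) (P : set I) (A : I -> set nat) :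
  (forall i, Sig l (A i)) -> Sig l (\bigcup_(i in P) A i).
Proof.
move=> hA.
have h (s : seq I) : Sig l [set x | exists i, [/\ i \in s, P i & A i x]].
  elim: s => [|i s ih]; first by apply: Sig_ext (Sig_set0 l) => x; split=> // -[? []].
  (* [P] does not depend on [x], so the case distinction is made outside the set. *)
  have [hi|hi] := EM (P i).
    apply: Sig_ext (SigU (hA i) ih) => x; split=> [[hx|[j [js hj hx]]]|[j []]].
    - by exists i; rewrite mem_head.
    - by exists j; rewrite inE js orbT.
    - by rewrite inE => /predU1P[->|js] hj hx; [left|right; exists j].
  apply: Sig_ext ih => x; split=> -[j [js hj hx]]; exists j; split=> //.
    by rewrite inE js orbT.
  by move: js hj; rewrite inE => /predU1P[->|].
apply: Sig_ext (h (enum I)) => x; split=> [[i [_ hi hx]]|[i hi hx]]; exists i => //.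
by rewrite mem_enum.
Qed.

Lemma Sig_bigcap l (I : finType) (P : set I) (A : I -> set nat) :
  (forall i, Sig l (A i)) -> Sig l (\bigcap_(i in P) A i).
Proof.
move=> hA.
have h (s : seq I) : Sig l [set x | forall i, i \in s -> P i -> A i x].
  elim: s => [|i s ih]; first by apply: Sig_ext (SigT l) => x; split.
  have [hi|hi] := EM (P i).
    apply: Sig_ext (SigI (hA i) ih) => x; split=> [[hx h] j|h].
      by rewrite inE => /predU1P[->//|/h].
    by split=> [|j js]; apply: h; rewrite // inE ?eqxx ?js ?orbT.
  apply: Sig_ext ih => x; split=> h j js; last by apply: h; rewrite inE js orbT.
  by move: js; rewrite inE => /predU1P[->|/h].
by apply: Sig_ext (h (enum I)) => x; split=> h' i;
  [apply: h'; rewrite mem_enum | move=> _; apply: h'].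
Qed.

(** * Trees *)

Lemma root_in (T : normal_tree) : [::] \in nodes T.
Proof.
have /fset0Pn[s hs] := nodes_neq0 T.
by apply: nodes_prefix hs; rewrite prefix0s.
Qed.

Definition root_node (T : normal_tree) : T := [` root_in T]%fset.

Lemma node_le_refl (T : normal_tree) (s : T) : node_le s s.
Proof. exact: prefix_refl. Qed.

Lemma node_le_trans (T : normal_tree) (t s u : T) :
  node_le s t -> node_le t u -> node_le s u.
Proof. exact: prefix_trans. Qed.

Lemma node_le_root (T : normal_tree) (s : T) : node_le (root_node T) s.
Proof. exact: prefix0s. Qed.

Lemma take_in (T : normal_tree) n (s : T) : take n (val s) \in nodes T.
Proof. by apply: nodes_prefix (valP s); exact: prefix_take. Qed.

Definition take_node (T : normal_tree) n (s : T) : T := [` take_in n s]%fset.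

Lemma node_le_take (T : normal_tree) n (s : T) : node_le (take_node n s) s.
Proof. exact: prefix_take. Qed.

Lemma node_le_takeE (T : normal_tree) (s t : T) :
  node_le s t -> take_node (size (val s)) t = s.
Proof. by rewrite /node_le prefixE => /eqP h; apply: val_inj. Qed.

Lemma node_le_size (T : normal_tree) (s t : T) :
  node_le s t -> size (val s) <= size (val t).
Proof. exact: size_prefix. Qed.

Lemma node_lt_size (T : normal_tree) (s t : T) :
  node_lt s t -> size (val s) < size (val t).
Proof.
move=> /andP[hst]; rewrite ltn_neqAle (node_le_size hst) andbT.
apply: contraNneq => e; rewrite -(node_le_takeE hst) e; apply/eqP/val_inj.
by rewrite /= take_size.
Qed.

Lemma node_le_anti (T : normal_tree) (s t : T) :
  node_le s t -> node_le t s -> s = t.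
Proof.
move=> hst /node_le_size hts; apply/eqP/negPn/negP => ne.
by have := @node_lt_size T s t; rewrite /node_lt hst ne ltnNge hts => /(_ isT).
Qed.

Lemma tilde_mem (T : normal_tree) (U : T -> set nat) s x :
  tilde U s x <-> U s x /\ forall t, node_lt s t -> ~ U t x.
Proof.
split=> [[h1 h2]|[h1 h2]]; split=> //.
  by move=> t lt_t hx; apply: h2; exists t.
by move=> [t lt_t]; apply: h2.
Qed.

(** A node of maximal length among those whose set contains [x] has no proper extension among
    them. *)
Lemma tilde_ex (T : normal_tree) (U : T -> set nat) x :
  U (root_node T) x -> exists s, tilde U s x.
Proof.
move=> h0.
have [s /asboolP hs max] := @arg_maxnP _ (root_node T) (fun s => `[< U s x >])
  (fun s => size (val s)) (asboolT h0).
exists s; apply/tilde_mem; split=> // t /node_lt_size lt_t ht.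
by have := max t (asboolT ht); rewrite /= leqNgt lt_t.
Qed.

Lemma Sig_tilde l (T : normal_tree) (U : T -> set nat) s :
  (forall t, Sig l (U t)) -> Sig l.+1 (tilde U s).
Proof.
move=> hU; apply: SigI; first exact: SigW.
by apply: SigC; apply: Sig_bigcup.
Qed.

Lemma Sig_eq_const l r c : recursive1 r -> Sig l [set x | r x = c].
Proof.
move=> hr; elim: l => [|l]; last exact: SigW.
apply/Sig0P; exists (fun x => (r x - c) + (c - r x)); last first.
  by move=> x /=; split; lia.
apply: (recursive1_comp2 recursive2_add).
  exact: (recursive1_comp2 recursive2_sub hr (recursive1_const c)).
exact: (recursive1_comp2 recursive2_sub (recursive1_const c) hr).
Qed.

Lemma val_root_node (T : normal_tree) (s : T) : val s = [::] -> s = root_node T.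
Proof. by move=> hs; apply: val_inj. Qed.

(** The root is its own parent. *)
Definition parent_node (T : normal_tree) (s : T) : T := take_node (size (val s)).-1 s.

Lemma node_le_parent_node (T : normal_tree) (s t : T) :
  node_le s t -> s = t \/ node_le s (parent_node t).
Proof.
move=> hst; have := node_le_size hst; rewrite leq_eqVlt => /predU1P[e|lt].
  by left; rewrite -(node_le_takeE hst); apply: val_inj; rewrite /= e take_size.
right; rewrite -(node_le_takeE hst) /node_le /= prefixE size_takel ?(ltnW lt) //.
by rewrite take_takel // -ltnS (ltn_predK lt).
Qed.

(* At every node at most one child is kept, the first one to be enumerated. *)
Lemma reduction l (T : normal_tree) (W : T -> set nat) :
  (forall s, Sig l.+1 (W s)) ->
  exists S : T -> set nat, [/\ forall s, Sig l.+1 (S s), S (root_node T) = setT,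
    forall s t, node_le s t -> S t `<=` S s,
    forall s t x, S s x -> S t x -> node_le s t || node_le t s &
    forall x, (forall s t, node_le s t -> W t x -> W s x) -> W (root_node T) x ->
      forall s, tilde S s x -> tilde W s x].
Proof.
move=> hW.
pose code (s : T) : nat := choice.pickle (val s).
have code_inj s t : code s = code t -> s = t.
  by move=> /(pcan_inj choice.pickleK)/val_inj.
pose sib (s : T) (x : nat) := pair (code s) (pair (code (parent_node s)) x).
(* For each pair of a parent and a point, [V] lists the children whose sets contain the point;
   uniformization keeps one of them. The root is left out because it would count as its own
   child. *)
pose V := \bigcup_(s in [set s : T | s != root_node T]) [set z |
  [/\ fst_of z = code s, fst_of (snd_of z) = code (parent_node s) &
      W s (snd_of (snd_of z))]].
have hV : Sig l.+1 V.
  apply: Sig_bigcup => s.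
  have h1 : Sig l.+1 [set z | fst_of z = code s].
    by apply: Sig_eq_const; rec1.
  have h2 : Sig l.+1 [set z | fst_of (snd_of z) = code (parent_node s)].
    by apply: Sig_eq_const; rec1.
  have h3 : Sig l.+1 [set z | W s (snd_of (snd_of z))].
    by apply: Sig_preimage (hW s); rec1.
  by apply: Sig_ext (SigI h1 (SigI h2 h3)) => z; split=> [[? []]|[]].
have [V' [hV' subV exV uniV]] := Sig_uniformization hV.
pose Z s := [set x | V' (sib s x)].
have subZ s : Z s `<=` W s.
  by move=> x /subV[t _ []]; rewrite /sib !pairE => /code_inj ->.
have exZ s x : s <> root_node T -> W s x ->
    exists2 t, parent_node t = parent_node s & t <> root_node T /\ Z t x.
  move=> /eqP ns hx.
  have [|j hj] := exV (code s) (pair (code (parent_node s)) x).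
    by exists s => //; rewrite /= !pairE.
  have [t /eqP nt []] := subV _ hj; rewrite !pairE => ej ep _; exists t.
    exact/esym/code_inj.
  by split=> //; rewrite /Z /sib /mkset -ej -ep.
have uniZ s t x : parent_node s = parent_node t -> Z s x -> Z t x -> s = t.
  move=> e; rewrite /Z /sib /mkset e => hs ht.
  by apply: code_inj; apply: uniV hs ht.
(* A point is in the set of [s] if every node on the path to [s] was kept for it; at the root the
   intersection is empty and gives everything. *)
exists (fun s => \bigcap_(r in [set r : T | node_le r s /\ r <> root_node T]) Z r).
split.
- move=> s; apply: Sig_bigcap => r; apply: Sig_preimage hV'.
  by rewrite /sib; rec1.
- apply/seteqP; split=> // x _ r [le_r []].
  exact: node_le_anti (node_le_root _).
- by move=> s t le_st x h r [le_rs nr]; apply: h; split=> //; apply: node_le_trans le_st.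
- move=> s t x hs ht.
  (* Two paths kept for the same [x] agree at every common length, since kept siblings coincide. *)
  have eq_take n : n <= size (val s) -> n <= size (val t) ->
      take_node n s = take_node n t.
    elim: n => [|n ih] lt_s lt_t; first by apply: val_inj; rewrite /= !take0.
    have parE (r : T) : n < size (val r) -> parent_node (take_node n.+1 r) = take_node n r.
      by move=> lt_r; apply: val_inj; rewrite /= size_takel //= take_takel.
    have nroot (r : T) : n < size (val r) -> take_node n.+1 r <> root_node T.
      by move=> lt_r /(congr1 val)/(congr1 size); rewrite /= size_takel.
    apply: (uniZ _ _ x).
    + by rewrite !parE // ih // ltnW.
    + by apply: hs; split; [exact: node_le_take|exact: nroot].
    + by apply: ht; split; [exact: node_le_take|exact: nroot].
  case/orP: (leq_total (size (val s)) (size (val t))) => le; apply/orP.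
    left; have := eq_take _ (leqnn _) le.
    rewrite (node_le_takeE (node_le_refl s)) => ->; exact: node_le_take.
  right; have := eq_take _ le (leqnn _).
  rewrite (node_le_takeE (node_le_refl t)) => <-; exact: node_le_take.
- move=> x mono hroot s /tilde_mem[hs hns]; apply/tilde_mem; split.
    have [-> //|ns] := EM (s = root_node T).
    by apply/subZ/hs; split=> //; exact: node_le_refl.
  move=> t lt_st ht; have lt_size := node_lt_size lt_st.
  have le_st : node_le s t by case/andP: lt_st.
  (* The child [c] of [s] towards [t] contains [x], so some child [c'] of [s] is kept for [x],
     against the maximality of [s]. *)
  pose c := take_node (size (val s)).+1 t.
  have size_c : size (val c) = (size (val s)).+1.
    by rewrite /= size_takel.
  have nc : c <> root_node T by move=> /(congr1 val)/(congr1 size); rewrite size_c.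
  have par_c : parent_node c = s.
    rewrite -(node_le_takeE le_st); apply: val_inj; rewrite /= -/(val c) size_c /=.
    by rewrite take_takel.
  have [c' ec [nc' hc']] := exZ c x nc (mono _ _ (node_le_take _ _) ht).
  have le_sc : node_le s c' by rewrite -par_c -ec; exact: node_le_take.
  apply: (hns c').
    rewrite /node_lt le_sc; apply/eqP => e; apply: nc'; apply: val_root_node.
    have := congr1 (size \o val) (etrans ec par_c); rewrite /= -e size_take.
    by case: (val s) => //= ? ?; case: ltngtP; lia.
  move=> r [le_r nr]; case: (node_le_parent_node le_r) => [-> //|].
  by rewrite ec par_c => le_rs; apply: hs.
Qed.

(** * Partitions determined by families *)

(** [SigmaT] over an arbitrary set [Y] and from an arbitrary level, as inductions on the depth of
    nesting require. *)
Definition partitioned k m n (Y : set nat) (T : iter_tree k m)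
    (A : nat -> kbar k) :=
  exists F : family_data T, is_family n Y F /\ determines F A.

Lemma partitioned0 k n Y (i : iter_tree k 0) A :
  partitioned n Y i A <-> (forall x, Y x -> A x = i).
Proof.
split=> [[F [/= ->]]|h]; first exact.
by exists Y.
Qed.

Lemma partitioned_intro k m n Y (T : qtree (iter_tree k m)) A
    (S : tree T -> set nat) :
  (forall s, Sig n.+1 (S s)) -> Y `<=` S (root_node _) ->
  (forall s t, node_le s t -> S t `<=` S s) ->
  (forall s, partitioned n.+1 (Y `&` tilde S s) (label s) A) ->
  @partitioned k m.+1 n Y T A.
Proof.
move=> hS hroot anti inner.
pose U s := Y `&` S s.
have tildeU s : tilde U s = Y `&` tilde S s.
  apply/predeqP => x; split=> [/tilde_mem[[Yx Sx] h]|[Yx /tilde_mem[Sx h]]].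
    by split=> //; apply/tilde_mem; split=> // t /h hx Stx; apply: hx.
  by apply/tilde_mem; split=> // t /h hx [].
(* Families are data, so one is selected at each node from a mere existence statement. *)
pose F s := projT1 (cid (inner s)).
have hF s : is_family n.+1 (Y `&` tilde S s) (F s) /\ determines (F s) A.
  exact: projT2 (cid (inner s)).
exists (U, F); split=> /=; last by move=> s; case: (hF s).
split=> [s|s /val_root_node ->|s t /anti|s].
- by exists (S s) => //; rewrite addn0; apply/SigmaNE.
- by apply/setIidl.
- exact: setIS.
- by rewrite tildeU; case: (hF s).
Qed.

Lemma partitioned_restrict k m n (Y Z : set nat) (T : iter_tree k m) A B :
  Z `<=` Y -> (forall x, Z x -> A x = B x) ->
  partitioned n Y T A -> partitioned n Z T B.
Proof.
elim: m n Y Z T => [|m ih] n Y Z T subZ eqA.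
  move=> /partitioned0 h; apply/partitioned0 => x Zx.
  by rewrite -eqA // h //; apply: subZ.
move=> [[U F] [/= [hU hroot anti inner] det]].
have /choice[S hS] s : exists S, Sig n.+1 S /\ U s = Y `&` S.
  by have [S /SigmaNE hS <-] := hU s; exists S; move: hS; rewrite addn0.
(* The sets [S] are monotone only within [Y]; intersecting along the path to [s] makes them monotone
   everywhere and full at the root. *)
pose S' s := \bigcap_(r in [set r | node_le r s /\ r <> root_node (tree T)]) S r.
have US' s : U s = Y `&` S' s.
  apply/seteqP; split=> x.
    move=> Ux; split; first by have [_] := hS s; move: Ux => + e; rewrite e => -[].
    move=> r [/anti le_r _]; have := le_r _ Ux.
    by have [_ ->] := hS r => -[].
  move=> [Yx Sx]; have [e|ns] := EM (s = root_node (tree T)).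
    by rewrite hroot // e.
  have [_ ->] := hS s; split=> //; apply: Sx; split=> //; exact: node_le_refl.
apply: (@partitioned_intro _ _ _ _ _ _ S').
- by move=> s; apply: Sig_bigcap => r; case: (hS r).
- by move=> x _ r [le_r []]; exact: node_le_anti (node_le_root _).
- by move=> s t le_st x h r [le_rs nr]; apply: h; split=> //; apply: node_le_trans le_st.
- move=> s; apply: (ih _ (tilde U s)).
  + move=> x [Zx /tilde_mem[Sx h]]; apply/tilde_mem; rewrite US'; split.
      by split=> //; apply: subZ.
    by move=> t /h hx; rewrite US' => -[_ /hx].
  + by move=> x [Zx _]; apply: eqA.
  + by exists (F s).
Qed.

(** Inside [Y] the reduced [tilde S s] is contained in [tilde U s], so the family given there
    restricts to it. *)
Lemma partitioned_elim k m n Y (T : qtree (iter_tree k m)) A :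
  @partitioned k m.+1 n Y T A -> exists S : tree T -> set nat,
  [/\ forall s, Sig n.+1 (S s), S (root_node _) = setT,
    forall s t, node_le s t -> S t `<=` S s,
    forall s t x, S s x -> S t x -> node_le s t || node_le t s &
    forall s, partitioned n.+1 (Y `&` tilde S s) (label s) A].
Proof.
move=> [[U F] [/= [hU hroot anti inner] det]].
have /choice[W hW] s : exists W, Sig n.+1 W /\ U s = Y `&` W.
  by have [W /SigmaNE hW <-] := hU s; exists W; move: hW; rewrite addn0.
have [S [hS rootS antiS compS tildeS]] := reduction (fun s => (hW s).1).
exists S; split=> // s.
apply: (@partitioned_restrict _ _ _ (tilde U s) _ _ A) => //; last by exists (F s).
have UW t x : Y x -> U t x <-> W t x.
  by move=> Yx; rewrite (hW t).2; split=> [[]|].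
move=> x [Yx /tildeS h].
have /tilde_mem[Wx h'] : tilde W s x.
  apply: h => [r t /anti h|]; first by rewrite -!UW //; apply: h.
  by rewrite -UW // hroot.
by apply/tilde_mem; rewrite UW //; split=> // t; rewrite UW //; apply: h'.
Qed.

(** The nodes whose sets contain [x] form a chain, which has at most one maximal element. *)
Lemma tilde_uniq (T : normal_tree) (S : T -> set nat) s t x :
  (forall s t x, S s x -> S t x -> node_le s t || node_le t s) ->
  tilde S s x -> tilde S t x -> s = t.
Proof.
move=> comp /tilde_mem[Ss hs] /tilde_mem[St ht].
apply/eqP/negPn/negP => ne; have /orP[le|le] := comp _ _ _ Ss St.
  by apply: (hs t) => //; rewrite /node_lt le.
by apply: (ht s) => //; rewrite /node_lt le eq_sym.
Qed.

Lemma tilde_le (T : normal_tree) (S : T -> set nat) s t x :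
  (forall s t, node_le s t -> S t `<=` S s) ->
  (forall s t x, S s x -> S t x -> node_le s t || node_le t s) ->
  tilde S t x -> S s x <-> node_le s t.
Proof.
move=> anti comp /tilde_mem[St ht]; split=> [Ss|/anti]; last by apply.
have /orP[//|le] := comp _ _ _ Ss St.
have [<-|ne] := eqVneq s t; first exact: node_le_refl.
by case: (ht s) => //; rewrite /node_lt le eq_sym.
Qed.

(** Used for the diagonal [pair x x] and for decoding indices in the universal partition. *)
Lemma partitioned_preimage k m n Y (T : iter_tree k m) A r :
  recursive1 r -> partitioned n Y T A ->
  partitioned n [set x | Y (r x)] T (fun x => A (r x)).
Proof.
move=> hr; elim: m n Y T => [|m ih] n Y T.
  by move=> /partitioned0 h; apply/partitioned0 => x /h.
move=> /partitioned_elim[S [hS rootS anti comp inner]].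
apply: (@partitioned_intro _ _ _ _ _ _ (fun s => [set x | S s (r x)])).
- by move=> s; apply: Sig_preimage.
- by move=> x _; rewrite /= rootS.
- by move=> s t /anti h x; apply: h.
- by move=> s; apply: partitioned_restrict (ih _ _ _ (inner s)).
Qed.

(** On [E i] the glued sets coincide with those of the [i]-th family. The diagonal argument uses
    this where several nodes of [V] are sent to one node of [T]. *)
Lemma partitioned_glue k m n (I : finType) (E : I -> set nat) Y
    (T : iter_tree k m) A :
  (forall i, Sig n.+1 (E i)) ->
  (forall i j x, E i x -> E j x -> i = j) ->
  (forall x, Y x -> exists i, E i x) ->
  (forall i, partitioned n (Y `&` E i) T A) ->
  partitioned n Y T A.
Proof.
elim: m n E Y T => [|m ih] n E Y T hE disj cover.
  move=> h; apply/partitioned0 => x Yx; have [i Ex] := cover x Yx.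
  by have /partitioned0 := h i; apply.
move=> h; have /choice[S hS] i := partitioned_elim (h i).
pose S' s := \bigcup_(i in setT) (E i `&` S i s).
have S'E i s x : E i x -> S' s x <-> S i s x.
  move=> Ex; split=> [[j _ [Ejx]]|Sx]; first by rewrite (disj _ _ _ Ex Ejx).
  by exists i.
have tildeE i s x : E i x -> tilde S' s x <-> tilde (S i) s x.
  move=> Ex; rewrite !tilde_mem (S'E i) //.
  by split=> -[Sx h']; split=> // t /h' hx; move: hx; rewrite (S'E i).
apply: (@partitioned_intro _ _ _ _ _ _ S').
- move=> s; apply: Sig_bigcup => i; apply: SigI => //.
  by case: (hS i).
- move=> x /cover[i Ex]; apply/(S'E i) => //.
  by have [_ ->] := hS i.
- move=> s t le_st x [i _ [Ex Sx]]; exists i => //; split=> //.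
  by have [_ _ anti _ _] := hS i; apply: anti Sx.
- move=> s; apply: (ih _ E).
  + by move=> i; apply: SigW.
  + by [].
  + by move=> x [/cover].
  + move=> i; have [_ _ _ _ inner] := hS i.
    apply: partitioned_restrict (inner s) => // x [[Yx Sx] Ex].
    by split=> //; apply/(tildeE i).
Qed.

Lemma partitioned_single k m n Y (T : iter_tree k m) A :
  @partitioned k m.+1 n Y (qtree_single T) A <-> partitioned n.+1 Y T A.
Proof.
split.
  move=> /partitioned_elim[S [hS rootS _ _ inner]].
  apply: partitioned_restrict (inner (root_node _)) => // x Yx; split=> //.
  apply/tilde_mem; rewrite rootS; split=> // t /node_lt_size /=.
  by move: (valP t); rewrite in_fset1 => /eqP ->.
move=> h; apply: (@partitioned_intro _ _ _ _ _ _ (fun=> setT)) => // [s|s].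
  exact: SigT.
by apply: partitioned_restrict h => // x [].
Qed.

(** A constant partition is insensitive to the level, which settles the bottom; higher up the
    embedding acts only on labels. Trees of different depths thereby become comparable. *)
Lemma partitioned_embed k m n Y (T : iter_tree k m) A :
  partitioned n Y (embed T) A <-> partitioned n Y T A.
Proof.
elim: m n Y T => [|m ih] n Y T.
  by rewrite [embed T]/(qtree_single T) partitioned_single !partitioned0.
split.
  move=> /partitioned_elim[S [hS rootS anti comp inner]].
  apply: (@partitioned_intro k m n Y T A S) => //; first by rewrite rootS.
  by move=> s; apply/ih; apply: inner.
move=> /partitioned_elim[S [hS rootS anti comp inner]].
apply: (@partitioned_intro k m.+1 n Y (qtree_map (@embed k m) T) A S) => //.
  by rewrite rootS.
by move=> s; apply/ih; apply: inner.
Qed.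

Lemma partitioned_embed_add k m n d Y (T : iter_tree k m) A :
  partitioned n Y (embed_add d T) A <-> partitioned n Y T A.
Proof. by elim: d => //= d ih; rewrite partitioned_embed. Qed.

Lemma partitioned_embed_to k m n p Y (T : iter_tree k m) A (le_mp : m <= p) :
  partitioned n Y (embed_to le_mp T) A <-> partitioned n Y T A.
Proof.
rewrite -(partitioned_embed_add n (p - m) Y T) /embed_to.
by move: (subnK le_mp); move: {le_mp} (p - m) => d e; case: p / e.
Qed.

(** * Universal partitions and diagonalization *)

(** An index codes, for every node, an index of its set in a universal Sigma set and an index for
    the universal partition of its label. *)
Lemma universal_partition k m n (T : iter_tree k m) :
  exists2 A, partitioned n setT T A &
    forall Y B, partitioned n Y T B ->
      exists e, forall x, Y x -> B x = A (pair e x).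
Proof.
elim: m n T => [|m ih] n T.
  exists (fun=> T); first by apply/partitioned0.
  by move=> Y B /partitioned0 h; exists 0.
have /choice[C hC] (s : tree T) : exists C, partitioned n.+1 setT (label s) C /\
    forall Y B, partitioned n.+1 Y (label s) B ->
      exists e, forall x, Y x -> B x = C (pair e x).
  by have [C ? ?] := ih n.+1 (label s); exists C.
have [X hX univ] := Sig_universal n.
pose coef (s : tree T) e := fst_of (iter (enum_rank s) snd_of e).
have rec_coef s r : recursive1 r -> recursive1 (fun z => coef s (r z)).
  move=> hr; apply: recursive1_fst.
  by apply: (recursive1_iter recursive1_snd_of) => //; rec1.
pose W s := [set z | X (pair (fst_of (coef s (fst_of z))) (snd_of z))].
have hW s : Sig n.+1 (W s).
  apply: Sig_preimage hX; apply: recursive1_pair; last by rec1.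
  by apply: recursive1_fst; apply: rec_coef; rec1.
(* For an arbitrary index the sets [W] need not be monotone, and incomparable ones may overlap;
   reduction produces a proper family in every case. *)
have [S [hS rootS anti comp tildeS]] := reduction hW.
have /choice[st hst] z : exists s, tilde S s z by apply: tilde_ex; rewrite rootS.
pose A z := C (st z) (pair (snd_of (coef (st z) (fst_of z))) (snd_of z)).
exists A.
  apply: (@partitioned_intro k m n setT T A S) => //; first by rewrite rootS.
  move=> s.
  have hr : recursive1
      (fun z => pair (snd_of (coef s (fst_of z))) (snd_of z)).
    apply: recursive1_pair; last by rec1.
    by apply: recursive1_snd; apply: rec_coef; rec1.
  apply: partitioned_restrict (partitioned_preimage hr (hC s).1) => // z [_ hz].
  by rewrite /A (tilde_uniq comp hz (hst z)).
move=> Y B /partitioned_elim[SB [hSB rootSB antiSB _ inner]].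
pose codes (s : tree T) c := (forall x, SB s x <-> X (pair (fst_of c) x)) /\
  (forall x, (Y `&` tilde SB s) x -> B x = C s (pair (snd_of c) x)).
have ex_codes s : exists c, codes s c.
  have [a ha] := univ _ (hSB s); have [b hb] := (hC s).2 _ _ (inner s).
  by exists (pair a b); split=> x; rewrite pairE; [exact: ha|exact: hb].
have [|e he] := @finite_choice_code #|tree T|
    (fun t c => forall s, enum_rank s = t :> nat -> codes s c).
  move=> t lt_t; have [c hc] := ex_codes (enum_val (Ordinal lt_t)).
  exists c => s es; rewrite (_ : s = enum_val (Ordinal lt_t)) //.
  by rewrite -[s]enum_rankK; congr enum_val; apply: val_inj.
have {}he s : codes s (coef s e) by exact: he _ (ltn_ord (enum_rank s)) s erefl.
exists e => x Yx; rewrite /A !pairE.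
set s := st _; have [_ ->] // := he s; split=> //.
have WE t : W t (pair e x) <-> SB t x.
  by rewrite /W /mkset !pairE; have [-> _] := he t.
(* For the index of [B] the section of [W] is [SB], monotone and full at the root, so reduction
   keeps [x] at a node where [B] puts it. *)
have /tilde_mem[hs hns] : tilde W s (pair e x).
  apply: tildeS (hst _) => [t u le_tu|]; rewrite !WE; last by rewrite rootSB.
  exact: antiSB.
by apply/tilde_mem; split=> [|t /hns]; rewrite ?WE // -WE.
Qed.

(* Determinacy of the game in which the players move upwards in [T] and [V]
   and the player in [T] aims at a label that is not below the one reached in
   [V]: [g] is a winning strategy in the absence of a monotone map. *)
Lemma not_qtree_le (Q : Type) (le : Q -> Q -> Prop) (T V : qtree Q) :
  ~ qtree_le le T V -> exists g : tree V -> tree T,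
    (forall s t, node_le s t -> node_le (g s) (g t)) /\
    (forall s, ~ le (label (g s)) (label s)).
Proof.
move=> nle.
(* Local version of the comparison: [f] maps the part of [T] above [t] into the part of [V] above
   [v]. The player in [T] keeps to positions where [H t v] fails. *)
pose maps (t : tree T) (v : tree V) (f : tree T -> tree V) :=
  (forall s u, node_le t s -> node_le s u -> node_le (f s) (f u)) /\
  (forall s, node_le t s -> node_le v (f s) /\ le (label s) (label (f s))).
pose H t v := exists f, maps t v f.
have Hdown t v v' : node_le v v' -> H t v' -> H t v.
  move=> le_v [f [f1 f2]]; exists f; split=> // s /f2[le_f ?].
  by split=> //; apply: node_le_trans le_f.
(* The answer to [v] is a longest [t'] above [t] at which [H t' v] still fails. *)
have settle v t : exists t', ~ H t v ->
    [/\ node_le t t', ~ H t' v & ~ le (label t') (label v)].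
  have [h|nH] := EM (H t v); first by exists t.
  have P0 : `[< node_le t t /\ ~ H t v >].
    by apply/asboolP; split=> //; exact: node_le_refl.
  have [t' /asboolP[le_t nH'] max] := @arg_maxnP _ t
    (fun t' => `[< node_le t t' /\ ~ H t' v >]) (fun t' => size (val t')) P0.
  exists t' => _; split=> // le_lab; apply: nH'.
  (* By maximality every node properly above [t'] has a local map. *)
  have /choice[F hF] u : exists f, node_lt t' u -> maps u v f.
    have [[f hf]|nHu] := EM (H u v); first by exists f.
    exists (fun=> v) => lt_u; exfalso.
    have : `[< node_le t u /\ ~ H u v >].
      apply/asboolP; split=> //; apply: node_le_trans le_t _.
      by case/andP: lt_u.
    by move/max; rewrite /= leqNgt (node_lt_size lt_u).
  pose c (u : tree T) := take_node (size (val t')).+1 u.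
  have hc u : node_le t' u -> u <> t' -> [/\ node_lt t' (c u), node_le (c u) u &
      forall w, node_le u w -> c w = c u].
    move=> le_u /eqP ne; have lt_u : node_lt t' u by rewrite /node_lt le_u eq_sym.
    have lt_size := node_lt_size lt_u.
    have size_c : size (val (c u)) = (size (val t')).+1 by rewrite /= size_takel.
    split; last 1 first.
    - move=> w le_w; apply: val_inj => /=.
      by rewrite -(node_le_takeE le_w) /= take_takel.
    - rewrite /node_lt; apply/andP; split; last first.
        by apply/eqP => e; have := size_c; rewrite -e => /n_Sn.
      by rewrite /node_le prefixE /= take_takel // -prefixE.
    - exact: node_le_take.
  (* If the label of [t'] were below that of [v], sending [t'] to [v] and using the local map of
     each child above it would give [H t' v]. *)
  exists (fun u => if u == t' then v else F (c u) u); split=> [s u le_s le_su|s le_s].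
    case: (eqVneq s t') => [es|/eqP ns].
      case: (eqVneq u t') => [_|/eqP nu]; first exact: node_le_refl.
      rewrite es in le_su; have [lt_c le_c _] := hc u le_su nu.
      by have [_ /(_ u le_c)[]] := hF _ lt_c.
    have [lt_c le_c /(_ u le_su) ec] := hc s le_s ns.
    case: (eqVneq u t') => [eu|nu].
      by case: ns; apply: node_le_anti le_s; rewrite -eu.
    by rewrite ec; have [mono _] := hF _ lt_c; apply: mono.
  case: (eqVneq s t') => [->|/eqP ns]; first by split=> //; exact: node_le_refl.
  have [lt_c le_c _] := hc s le_s ns.
  by have [_] := hF _ lt_c; apply.
have /choice[st hst] : forall v, exists f : tree T -> tree T, forall t, ~ H t v ->
    [/\ node_le t (f t), ~ H (f t) v & ~ le (label (f t)) (label v)].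
  by move=> v; have /choice[f hf] := settle v; exists f.
(* The strategy answers along the path to [v], from the root of [T]; the recursion runs on the
   length of [v]. *)
pose fix gs (N : nat) (v : tree V) {struct N} : tree T :=
  st v (if N is N'.+1 then gs N' (parent_node v) else root_node (tree T)).
pose g v := gs (size (val v)) v.
have size_parent (v : tree V) : size (val (parent_node v)) = (size (val v)).-1.
  by rewrite /= size_takel // leq_pred.
have gE v : val v <> [::] -> g v = st v (g (parent_node v)).
  rewrite /g size_parent.
  by case: (size (val v)) (@size0nil _ (val v)) => //= h /(_ (h erefl)).
have ginv N v : size (val v) = N -> ~ H (g v) v /\ ~ le (label (g v)) (label v).
  elim: N v => [|N ih] v size_v.
    (* A local map from the root of [T] would be a monotone map of the whole tree. *)
    have nH : ~ H (root_node (tree T)) v.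
      move=> /(Hdown _ _ _ (node_le_root v))[f [f1 f2]]; apply: nle; exists f.
      by split=> [s t|s]; [apply: f1|apply: (f2 _ _).2]; exact: node_le_root.
    by rewrite /g size_v /=; case: (hst v _ nH).
  have nv : val v <> [::] by move=> e; rewrite e in size_v.
  have [nH _] := ih _ (etrans (size_parent v) (congr1 predn size_v)).
  have nH' : ~ H (g (parent_node v)) v.
    by move=> h; apply: nH; apply: Hdown (node_le_take _ _) h.
  by rewrite gE //; case: (hst v _ nH').
exists g; split=> [s t le_st|s]; last by have [] := ginv _ s erefl.
elim: {t}(size (val t)) {-2}t (erefl (size (val t))) le_st => [|N ih] t size_t le_st.
  have -> : s = t; last exact: node_le_refl.
  apply: node_le_anti le_st _.
  by rewrite [t]val_root_node ?node_le_root //; apply: size0nil.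
case: (node_le_parent_node le_st) => [->|le_s]; first exact: node_le_refl.
apply: node_le_trans (ih _ _ le_s) _; first by rewrite size_parent size_t.
have nH' : ~ H (g (parent_node t)) t.
  have [nH _] := ginv _ (parent_node t) erefl.
  by move=> h; apply: nH; apply: Hdown (node_le_take _ _) h.
rewrite (gE t); first by case: (hst t _ nH').
by move=> e; rewrite e in size_t.
Qed.

Lemma diagonal_partition k m n Y (T V : iter_tree k m) B :
  ~ iter_le T V -> partitioned n Y V B ->
  exists2 A, partitioned n Y T A & forall x, Y x -> A x <> B x.
Proof.
elim: m n Y T V => [|m ih] n Y T V.
  move=> neq /partitioned0 hB; exists (fun=> T); first by apply/partitioned0.
  by move=> x /hB ->.
move=> /not_qtree_le[g [gmono gdiff]].
move=> /partitioned_elim[S [hS rootS anti comp inner]].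
have /choice[C hC] v : exists C,
    partitioned n.+1 (Y `&` tilde S v) (label (g v)) C /\
    forall x, (Y `&` tilde S v) x -> C x <> B x.
  by have [C ? ?] := ih _ _ _ _ (gdiff v) (inner v); exists C.
have /choice[st hst] x : exists v, tilde S v x by apply: tilde_ex; rewrite rootS.
pose A x := C (st x) x.
exists A; last by move=> x Yx; apply: (hC (st x)).2; split.
(* By monotonicity of [g], a point that [V] puts at [v] lies in [U s] exactly when [s] is below
   [g v], so it ends at the node [g v] of [T]. *)
pose U s := \bigcup_(v in [set v | node_le s (g v)]) S v.
have UE s v x : tilde S v x -> U s x <-> node_le s (g v).
  move=> hv; split=> [[w /= le_s Sw]|le_s].
    by apply: node_le_trans le_s (gmono _ _ _); apply/(tilde_le _ anti comp hv).
  by exists v => //; case/tilde_mem: hv.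
apply: (@partitioned_intro k m n Y T A U).
- by move=> s; apply: Sig_bigcup.
- by move=> x _; exists (root_node _); rewrite ?rootS //; exact: node_le_root.
- by move=> s t le_st x [v le_t Sv]; exists v => //; apply: node_le_trans le_t.
move=> s.
have tildeUE v x : tilde S v x -> tilde U s x -> g v = s.
  move=> hv /tilde_mem[/(UE _ _ _ hv) le_s hns].
  apply/eqP/negPn/negP => ne; apply: (hns (g v)).
    by rewrite /node_lt le_s eq_sym.
  by apply/(UE _ _ _ hv); exact: node_le_refl.
(* The pieces [tilde S v] with [g v = s] are differences, hence one level up, where the family at
   [s] lives. *)
apply: (@partitioned_glue k m n.+1 {v : tree V | g v == s}
  (fun v => tilde S (val v))).
- by move=> v; apply: Sig_tilde.
- by move=> v w x hv hw; apply: val_inj; apply: tilde_uniq comp hv hw.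
- move=> x [_ hx]; have /eqP gv := tildeUE _ _ (hst x) hx.
  by exists (exist (fun v => g v == s) _ gv); exact: hst.
move=> [v /= /eqP gv]; have := (hC v).1; rewrite gv.
apply: partitioned_restrict => [x [[Yx _] hx] //|x [_ hx]].
by rewrite /A (tilde_uniq comp (hst x) hx).
Qed.

Theorem theorem5p6 (k : option nat) (hk : two_le k) (T : omega_tree k) :
  ~ (SigmaT T `<=` \bigcup_(V in [set V : omega_tree k | ~ omega_le T V]) SigmaT V).
Proof.
have [A hA univ] := universal_partition 0 (projT2 T).
move=> /(_ A hA)[V nle hV].
have rec_diag : recursive1 (fun x => pair x x) by rec1.
have := partitioned_preimage rec_diag hV.
(* [omega_le] compares at the larger depth: [V] is lifted there, and [B] is afterwards brought back
   to [T]. *)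
rewrite -(partitioned_embed_to _ _ _ _ (leq_maxr (projT1 T) (projT1 V))) /=.
move=> /(diagonal_partition nle)[B].
rewrite partitioned_embed_to => /univ[e he] neq.
by have := neq e I; rewrite he.
Qed.
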